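(* Let $n$ be a positive integer and let $X=\{X_1,\dots,X_{n+2}\}$ be a set of $n+2$ cycles in $\mathbb{R}^n$. Suppose that for every $1\le i\le n+2$ there are exactly two distinct cycles $A_i$ and $A_i'$ tangent to every cycle of $X\setminus\{X_i\}$, i.e. $Ap(X\setminus\{X_i\})=\{A_i,A_i'\}$ with $A_i\ne A_i'$. Then the lines through the centers of the pairs $A_1,A_1'$; $A_2,A_2'$; $\dots$; $A_{n+2},A_{n+2}'$ are concurrent.
   Context: Let $V=\mathbb{R}^{n+3}$ with the symmetric bilinear form of signature $(n+1,2)$ $$(X|Y)=-x_1y_1+\sum_{i=2}^{n+1}x_iy_i+x_{n+2}y_{n+3}+x_{n+3}y_{n+2}.$$ Let $\mathbb{P}(V)$ be the projective space of $V$, and let $[X]$ be the class of a nonzero $X\in V$. The Lie quadric is $Q=\{[X]\in\mathbb{P}(V):(X|X)=0\}$. Cycles (oriented spheres, point spheres and oriented hyperplanes) in $\mathbb{R}^n$ are represented by points of $Q$. The point $[X]\in Q$ with $X=(r,c_1,\dots,c_n,v,w)$ represents the set $\{x\in\mathbb{R}^n: v|x|^2-2(c_1x_1+\dots+c_nx_n)-2w=0\}$, where $2vw=r^2-(c_1^2+\dots+c_n^2)$. If $v\ne0$ it is an oriented sphere with center $(c_1/v,\dots,c_n/v)$ and signed radius $r/v$ (possibly $0$); if $v=0$ it is an oriented hyperplane. A cycle is identified with the point of $Q$ representing it. Two cycles $[X],[Y]$ are tangent iff $(X|Y)=0$ (oriented contact). For cycles $[Y_1],\dots,[Y_k]$ put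 $Ap([Y_1],\dots,[Y_k])=\{[X]\in Q:(X|Y_j)=0 \text{ for all } j\}$. The center of a cycle is the homogeneous point $[c_1:\dots:c_n:v]\in\mathbb{RP}^n$; it is a point at infinity when $v=0$. The line through two centers is the projective line in $\mathbb{RP}^n$ through them, considered whenever the two centers are defined (that is, $(c_1,\dots,c_n,v)\neq 0$) and distinct. Concurrent means having a common point in $\mathbb{RP}^n$ (possibly at infinity). *)

(* Defs.v *)
From HB Require Import structures.
From mathcomp Require Import all_boot all_order all_algebra.
From mathcomp Require Import classical_sets reals.

Set Implicit Arguments.
Unset Strict Implicit.
Unset Printing Implicit Defensive.

Import Order.TTheory GRing.Theory Num.Theory.
Local Open Scope classical_set_scope.
Local Open Scope ring_scope.

Definition proj (K : fieldType) (V : vectType K) : Type :=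
  {U : {vspace V} | \dim U == 1%N}.

Section Projective.
Variables (K : fieldType) (V : vectType K).

(* [represents X P] is P = [X]; as \dim (val P) = 1, it forces X != 0. *)
Definition represents (X : V) (P : proj V) : Prop := val P = <[X]>%VS.

Definition proj_line (P P' : proj V) : set (proj V) :=
  [set Z | (val Z <= val P + val P')%VS].

(* An empty collection of sets counts as concurrent. *)
Definition concurrent (L : set (set (proj V))) : Prop :=
  \bigcap_(l in L) l !=set0.

Lemma represents_neq0 (X : V) (P : proj V) : represents X P -> X != 0.
Proof.
case: P => U dU; rewrite /represents /= => rX.
by move: dU; rewrite rX dim_vline; case: (X != 0).
Qed.

Lemma represents_class (X : V) : X != 0 -> exists P : proj V, represents X P.
Proof.
move=> X0; have dX : \dim <[X]>%VS == 1%N by rewrite dim_vline X0.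
by exists (exist (fun U : {vspace V} => \dim U == 1%N) _ dX).
Qed.

Lemma represents_ex (P : proj V) : exists X : V, represents X P.
Proof.
exists (vpick (val P)); apply/esym/eqP; rewrite eqEdim.
rewrite -memvE memv_pick dim_vline vpick0 (eqP (valP P)).
by case: eqP => // P0; move: (valP P); rewrite P0 dimv0.
Qed.

Lemma represents_scale (X Y : V) (P : proj V) :
  represents X P -> represents Y P -> exists2 k, k != 0 & Y = k *: X.
Proof.
move=> rX rY; have: Y \in <[X]>%VS by rewrite -rX rY memv_line.
case/vlineP => k Yk; exists k => //; apply/eqP => k0.
by move: (represents_neq0 rY); rewrite Yk k0 scale0r eqxx.
Qed.

End Projective.

Section LieQuadric.
Variables (R : realType) (n : nat).

Local Notation V := 'rV[R]_n.+3.

(* Coordinates of X = (r, c_1, ..., c_n, v, w), at positions 0, ..., n + 2. *)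
Definition coord_r (X : V) : R := X 0 ord0.
Definition coord_c (X : V) (i : 'I_n) : R := X 0 (inord i.+1).
Definition coord_v (X : V) : R := X 0 (inord n.+1).
Definition coord_w (X : V) : R := X 0 (inord n.+2).

Definition lie_form (X Y : V) : R :=
  - (coord_r X * coord_r Y) + \sum_(i < n) coord_c X i * coord_c Y i
  + coord_v X * coord_w Y + coord_w X * coord_v Y.

(* Independent of the choice of representatives: see tangentE and
   lie_quadricE. *)
Definition tangent (P P' : proj V) : Prop :=
  forall X Y : V, represents X P -> represents Y P' -> lie_form X Y = 0.

Definition lie_quadric : set (proj V) :=
  [set P | exists2 X : V, represents X P & lie_form X X = 0].

Definition Ap (S : set (proj V)) : set (proj V) :=
  [set P | lie_quadric P /\ forall P', S P' -> tangent P P'].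

Definition center_vec (X : V) : 'rV[R]_n.+1 :=
  \row_(i < n.+1) if unlift ord_max i is Some j then coord_c X j else coord_v X.

(* The center of P is C = [c_1 : ... : c_n : v]; there is no such C when
   (c_1, ..., c_n, v) = 0. *)
Definition is_center (P : proj V) (C : proj 'rV[R]_n.+1) : Prop :=
  exists2 X : V, represents X P & represents (center_vec X) C.

(* Indices i for which a center is undefined, or for which the two centers
   coincide, contribute no line. *)
Definition center_lines (I : Type) (A A' : I -> proj V) :
    set (set (proj 'rV[R]_n.+1)) :=
  [set l | exists i C C', [/\ is_center (A i) C, is_center (A' i) C',
                              C <> C' & l = proj_line C C']].

Lemma lie_formZ (a b : R) (X Y : V) :
  lie_form (a *: X) (b *: Y) = a * b * lie_form X Y.
Proof.
rewrite /lie_form /coord_r /coord_c /coord_v /coord_w !mxE.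
under eq_bigr => i _ do rewrite !mxE mulrACA.
by rewrite -mulr_sumr !(mulrACA a _ b) -mulrN -!mulrDr.
Qed.

Lemma tangentE (P P' : proj V) (X Y : V) :
  represents X P -> represents Y P' -> tangent P P' <-> lie_form X Y = 0.
Proof.
move=> rX rY; split=> [|XY X' Y' rX' rY']; first exact.
have [a _ ->] := represents_scale rX rX'.
have [b _ ->] := represents_scale rY rY'.
by rewrite lie_formZ XY mulr0.
Qed.

Lemma lie_quadricE (P : proj V) (X : V) :
  represents X P -> lie_quadric P <-> lie_form X X = 0.
Proof.
move=> rX; split=> [[Y rY YY]|XX]; last by exists X.
by have [a _ ->] := represents_scale rY rX; rewrite lie_formZ YY mulr0.
Qed.

Lemma center_vecZ (a : R) (X : V) : center_vec (a *: X) = a *: center_vec X.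
Proof.
apply/rowP => i; rewrite !mxE; case: unlift => [j|].
  by rewrite /coord_c mxE.
by rewrite /coord_v mxE.
Qed.

Lemma is_centerE (P : proj V) (X : V) (C : proj 'rV[R]_n.+1) :
  represents X P -> is_center P C <-> represents (center_vec X) C.
Proof.
move=> rX; split=> [[Y rY rC]|rC]; last by exists X.
have [a a0 ->] := represents_scale rY rX; rewrite center_vecZ /represents rC.
apply/eqP; rewrite eqEdim -memvE; apply/andP; split.
  by apply/vlineP; exists a^-1; rewrite scalerA mulVf // scale1r.
by rewrite !dim_vline scaler_eq0 (negPf a0).
Qed.

End LieQuadric.

(* Main.v *)
From HB Require Import structures.
Require Import Defs.
From mathcomp Require Import all_boot all_order all_algebra.
From mathcomp Require Import classical_sets reals.
From mathcomp Require Import boolp ring.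

(** A nonzero vector [t] orthogonal to all [n + 2] cycles exists by counting
    dimensions.  For each [i] it lies in the orthogonal of the remaining cycles;
    that space has exactly two isotropic lines [A i] and [A' i], which forces it
    to be the hyperbolic plane they span.  Taking centers is linear, so the
    center of [t] lies on every line.  If [t] has no center, then the centers of
    each pair are dependent, and there is no line at all. *)

Set Implicit Arguments.
Unset Strict Implicit.
Unset Printing Implicit Defensive.

Import GRing.Theory.

Local Open Scope classical_set_scope.
Local Open Scope ring_scope.

Section Projective.
Context {K : fieldType} {V : vectType K}.
Implicit Types (X Y : V) (P Q : proj V).

Lemma proj_eq_mem X Y P Q :
  represents X P -> represents Y Q -> X \in <[Y]>%VS -> P = Q.
Proof.
move=> rX rY XY; apply: val_inj; apply/eqP; rewrite eqEdim.
by rewrite (eqP (valP P)) (eqP (valP Q)) andbT rX rY -memvE.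
Qed.

(** Distinct points of projective space have independent representatives: with [a] invertible, [X]
    would lie on the line of [Y]. *)
Lemma proj_neq_comb a b X Y P Q :
  represents X P -> represents Y Q -> P <> Q ->
  a *: X + b *: Y = 0 -> a = 0 /\ b = 0.
Proof.
move=> rX rY PQ abXY.
have a0 : a = 0.
  apply: contrapT => /eqP aN0; apply: PQ; apply: (proj_eq_mem rX rY).
  apply/vlineP; exists (- (a^-1 * b)).
  apply: (scalerI aN0); rewrite scalerA mulrN mulrA divff // mul1r scaleNr.
  by apply/eqP; rewrite -addr_eq0 abXY.
split=> //; move: abXY; rewrite a0 scale0r add0r => /eqP.
by rewrite scaler_eq0 (negPf (represents_neq0 rY)) orbF => /eqP.
Qed.

End Projective.

Section LieForm.
Context {R : realType} {n : nat}.
Implicit Types (X Y Z : 'rV[R]_n.+3).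

Lemma lie_formC X Y : lie_form X Y = lie_form Y X.
Proof.
rewrite /lie_form; under eq_bigr => i _ do rewrite mulrC.
by ring.
Qed.

Lemma lie_formDl X Y Z : lie_form (X + Y) Z = lie_form X Z + lie_form Y Z.
Proof.
rewrite /lie_form /coord_r /coord_c /coord_v /coord_w !mxE.
under eq_bigr => i _ do rewrite !mxE mulrDl.
by rewrite big_split /=; ring.
Qed.

Lemma lie_formDr X Y Z : lie_form X (Y + Z) = lie_form X Y + lie_form X Z.
Proof. by rewrite lie_formC lie_formDl !(lie_formC X). Qed.

Lemma lie_formZl a X Y : lie_form (a *: X) Y = a * lie_form X Y.
Proof. by rewrite -[Y in LHS]scale1r lie_formZ mulr1. Qed.

Lemma lie_formZr a X Y : lie_form X (a *: Y) = a * lie_form X Y.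
Proof. by rewrite lie_formC lie_formZl lie_formC. Qed.

Lemma center_vecD X Y : center_vec (X + Y) = center_vec X + center_vec Y.
Proof.
apply/rowP => i; rewrite !mxE; case: unlift => [j|].
  by rewrite /coord_c mxE.
by rewrite /coord_v mxE.
Qed.

(** Pairing with the [x j] is a linear map from dimension [n + 3] to dimension [m], so its kernel is
    nonzero. *)
Lemma lie_form_common_orthogonal m (x : 'I_m -> 'rV[R]_n.+3) : (m < n.+3)%N ->
  exists2 t : 'rV[R]_n.+3, t != 0 & forall j, lie_form t (x j) = 0.
Proof.
move=> mn; pose f (t : 'rV[R]_n.+3) : 'rV[R]_m := \row_j lie_form t (x j).
have f_lin : linear f.
  by move=> a u v; apply/rowP => j; rewrite !mxE lie_formDl lie_formZl.
pose fL := HB.pack_for {linear 'rV[R]_n.+3 -> 'rV[R]_m} f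
  (GRing.isLinear.Build _ _ _ _ f f_lin).
have : kermx (lin1_mx fL) != 0.
  rewrite kermx_eq0 /row_free neq_ltn.
  by rewrite (leq_ltn_trans (rank_leq_col _) mn).
case/rowV0Pn => t /sub_kermxP; rewrite mul_rV_lin1 => /rowP ft t0.
by exists t => // j; have := ft j; rewrite !mxE.
Qed.

(** Passes from vector equations to points of [Ap S], so that a description of [Ap S] constrains
    vectors. *)
Lemma Ap_nonzero (S : set (proj 'rV[R]_n.+3)) X :
  lie_form X X = 0 ->
  (forall P Y, S P -> represents Y P -> lie_form X Y = 0) -> X != 0 ->
  exists2 P, represents X P & Ap S P.
Proof.
move=> XX XS /represents_class [P rX]; exists P => //; split.
  exact/(lie_quadricE rX).
move=> P' SP'; have [Y rY] := represents_ex P'.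
exact/(tangentE rX rY)/(XS _ _ SP' rY).
Qed.

(** Adding suitable multiples of [a] and [a'] to [t] gives an isotropic vector still orthogonal to
    [S]; such a vector is a multiple of [a] or of [a']. *)
Lemma Ap_pair_span (S : set (proj 'rV[R]_n.+3)) (A A' : proj 'rV[R]_n.+3)
    (a a' t : 'rV[R]_n.+3) :
  A <> A' -> Ap S = [set A; A'] -> represents a A -> represents a' A' ->
  (forall P Y, S P -> represents Y P -> lie_form t Y = 0) ->
  exists k k', t = k *: a + k' *: a'.
Proof.
move=> AA' ApS ra ra' tS.
have [qA tA] : Ap S A by rewrite ApS; left.
have [qA' tA'] : Ap S A' by rewrite ApS; right.
have aa := (lie_quadricE ra).1 qA; have a'a' := (lie_quadricE ra').1 qA'.
have aS P Y : S P -> represents Y P -> lie_form a Y = 0.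
  by move=> SP rY; exact/(tangentE ra rY)/tA.
have a'S P Y : S P -> represents Y P -> lie_form a' Y = 0.
  by move=> SP rY; exact/(tangentE ra' rY)/tA'.
have isotropic_span y : lie_form y y = 0 ->
    (forall P Y, S P -> represents Y P -> lie_form y Y = 0) ->
    exists k k', y = k *: a + k' *: a' /\ (k = 0 \/ k' = 0).
  move=> yy yS; have [->|y0] := eqVneq y 0.
    by exists 0, 0; rewrite !scale0r addr0; split=> //; left.
  have [P ry] := Ap_nonzero yy yS y0; rewrite ApS => -[] /= PA; rewrite PA in ry.
    have [k _ ->] := represents_scale ra ry.
    by exists k, 0; rewrite scale0r addr0; split=> //; right.
  have [k _ ->] := represents_scale ra' ry.
  by exists 0, k; rewrite scale0r add0r; split=> //; left.
(* Otherwise [a + a'] would be isotropic and orthogonal to [S], hence a multiple of [a] or of [a'],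
   against their independence. *)
have aa'N0 : lie_form a a' != 0.
  apply/eqP => aa'.
  have [||k [k' [E kk']]] := isotropic_span (a + a').
  - by rewrite !lie_formDl !lie_formDr (lie_formC a' a) aa a'a' aa' !addr0.
  - by move=> P Y SP rY; rewrite lie_formDl (aS P) ?(a'S P) ?addr0.
  have [k1 k'1] : 1 - k = 0 /\ 1 - k' = 0.
    apply: (proj_neq_comb ra ra' AA').
    by rewrite !scalerBl !scale1r addrACA -opprD E subrr.
  by case: kk' => kk'; [move: k1 | move: k'1]; rewrite kk' subr0 => /eqP;
    rewrite oner_eq0.
(* [u] is [t] made orthogonal to [a] and [a'], and [s] makes [a + s a' + u]
   isotropic. *)
pose h := lie_form a a'.
pose p := lie_form t a' / h; pose p' := lie_form t a / h.
have [u uE] : exists u, u = t + (- p) *: a + (- p') *: a' by eexists.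
have ua : lie_form u a = 0.
  by rewrite uE !lie_formDl !lie_formZl aa (lie_formC a') /p' /h; field.
have ua' : lie_form u a' = 0.
  by rewrite uE !lie_formDl !lie_formZl a'a' /p /h; field.
pose s := - lie_form u u / (2 * h).
have [||k [k' [E _]]] := isotropic_span (a + s *: a' + u).
- rewrite !lie_formDl !lie_formDr !lie_formZl !lie_formZr.
  rewrite (lie_formC a u) (lie_formC a' u) (lie_formC a' a) ua ua' aa a'a'.
  by rewrite -/h /s; field.
- move=> P Y SP rY; rewrite uE !lie_formDl !lie_formZl.
  by rewrite (aS P) ?(a'S P) ?(tS P) // !mulr0 !addr0.
(* Solve [a + s a' + u = k a + k' a'] for [t], using [u = t - p a - p' a']. *)
exists (k + p - 1), (k' + p' - s).
have -> : t = (a + s *: a' + u) + ((p - 1) *: a + (p' - s) *: a').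
  by apply/rowP => j; rewrite uE !mxE; ring.
by rewrite E addrACA -!scalerDl !addrA.
Qed.

End LieForm.

Theorem proposition3p1 (R : realType) (n : nat) (n_gt0 : (0 < n)%N)
    (X : 'I_n.+2 -> proj 'rV[R]_n.+3)
    (X_inj : injective X)
    (X_cycle : forall i, lie_quadric (X i))
    (A A' : 'I_n.+2 -> proj 'rV[R]_n.+3)
    (A_neq : forall i, A i <> A' i)
    (ApX : forall i, Ap (range X `\ X i) = [set A i; A' i]) :
  concurrent (center_lines A A').
Proof.
have [x rx] := choice (fun j => represents_ex (X j)).
have [t t0 tx] := lie_form_common_orthogonal x (ltnSn _).
(* Stated for arbitrary representatives, since each [is_center] hypothesis brings its own. *)
have t_span i a a' : represents a (A i) -> represents a' (A' i) ->
    exists k k', t = k *: a + k' *: a'.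
  move=> ra ra'; apply: (Ap_pair_span (A_neq i) (ApX i) ra ra').
  move=> _ Y [[j _ <-] _] rY.
  by have [b _ ->] := represents_scale (rx j) rY; rewrite lie_formZr tx mulr0.
have [ct0|/represents_class [P rP]] := eqVneq (center_vec t) 0.
  (* Any point serves here, because the family of lines is empty: two distinct centers are
     independent, so [center_vec t = 0] would give [k = k' = 0] and [t = 0]. *)
  have [P _] : exists P, represents (delta_mx 0 0 : 'rV[R]_n.+1) P.
    apply: represents_class; apply/eqP => /matrixP /(_ 0 0).
    by rewrite !mxE !eqxx => /eqP; rewrite oner_eq0.
  exists P => l [i [C [C' [[a ra rC] [a' ra' rC'] CC' _]]]]; exfalso.
  have [k [k' E]] := t_span i a a' ra ra'.
  move: ct0; rewrite E center_vecD !center_vecZ.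
  case/(proj_neq_comb rC rC' CC') => k0 k'0.
  by move: t0; rewrite E k0 k'0 !scale0r addr0 eqxx.
exists P => l [i [C [C' [[a ra rC] [a' ra' rC'] _ ->]]]].
have [k [k' E]] := t_span i a a' ra ra'.
rewrite /proj_line /= rP rC rC' -memvE E center_vecD !center_vecZ.
by apply: memv_add; apply: memvZ; apply: memv_line.
Qed.
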